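(* Let $\phi\in\mathcal{H}^2_2(\mathbb{D})$ be such that $\|\phi\|_\infty<1$. Then the composition operator $C_\phi$ is a Hilbert-Schmidt operator on $\mathcal{H}^2_2(\mathbb{D})$.
   Context: $\mathbb{D}$ is the open unit disk in $\mathbb{C}$, $H(\mathbb{D})$ is the space of holomorphic functions on $\mathbb{D}$, and $\|f\|_\infty=\sup_{z\in\mathbb{D}}|f(z)|$. $\mathcal{H}^2_2(\mathbb{D})$ is the Hilbert space of all $f(z)=\sum_{n\ge0}a_nz^n\in H(\mathbb{D})$ with $\|f\|^2_{\mathcal{H}^2_2}=\sum_{n\ge0}\frac{(n+2)^5}{n+1}|a_n|^2<\infty$, with inner product $\langle \sum a_nz^n,\sum b_nz^n\rangle_{\mathcal{H}^2_2}=\sum_{n\ge0}\frac{(n+2)^5}{n+1}a_n\overline{b_n}$. For holomorphic $\phi:\mathbb{D}\to\mathbb{D}$, $C_\phi f=f\circ\phi$. An operator $T$ on a Hilbert space is Hilbert-Schmidt if there is an orthonormal basis $\{e_n\}_{n\ge0}$ with $\sum_{n=0}^\infty\|Te_n\|^2<\infty$. *)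

(* Defs.v *)
From Stdlib Require Export Reals.
From Stdlib Require Import Lra ClassicalEpsilon FunctionalExtensionality.
From Coquelicot Require Export Coquelicot.

Open Scope R_scope.

(* A function on the open unit disk is represented by a function C -> C whose
   values off the disk are irrelevant: membership, coefficients, norm and inner
   product below only depend on the values on the disk. *)
Definition in_disk (z : C) : Prop := Cmod z < 1.

Definition holomorphic_on_disk (f : C -> C) : Prop :=
  forall z : C, in_disk z -> @ex_derive C_AbsRing C_NormedModule f z.

Definition has_expansion (f : C -> C) (a : nat -> C) : Prop :=
  forall z : C, in_disk z -> @is_pseries C_AbsRing C_NormedModule a z (f z).

Lemma is_pseries_fst_snd (a : nat -> C) (x : R) (l : C) :
  @is_pseries C_AbsRing C_NormedModule a (RtoC x) l ->
  is_pseries (fun n => fst (a n)) x (fst l) /\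
  is_pseries (fun n => snd (a n)) x (snd l).
Proof.
  intros H.
  assert (Hpow : forall n, pow_n (K := C_Ring) (RtoC x) n = RtoC (pow_n x n)).
  { induction n as [|n IH]; [reflexivity|].
    simpl; rewrite IH; symmetry; apply RtoC_mult. }
  assert (Hsum : forall n,
    sum_n (fun k => scal (V := C_ModuleSpace) (pow_n (K := C_Ring) (RtoC x) k) (a k)) n
    = (sum_n (fun k => scal (pow_n x k) (fst (a k))) n,
       sum_n (fun k => scal (pow_n x k) (snd (a k))) n)).
  { assert (Hk : forall k, scal (V := C_ModuleSpace) (pow_n (K := C_Ring) (RtoC x) k) (a k)
      = (scal (pow_n x k) (fst (a k)), scal (pow_n x k) (snd (a k)))).
    { intros k; rewrite Hpow. unfold scal; simpl; unfold mult; simpl.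
      unfold Cmult; simpl; f_equal; ring. }
    induction n as [|n IH].
    - rewrite !sum_O; apply Hk.
    - rewrite !sum_Sn, IH, Hk; reflexivity. }
  split.
  - apply (filterlim_ext (fun n => fst (sum_n (fun k => scal (V := C_ModuleSpace)
      (pow_n (K := C_Ring) (RtoC x) k) (a k)) n))).
    + intros n; now rewrite Hsum.
    + eapply filterlim_comp; [exact H|].
      apply (@continuous_fst R_UniformSpace R_UniformSpace).
  - apply (filterlim_ext (fun n => snd (sum_n (fun k => scal (V := C_ModuleSpace)
      (pow_n (K := C_Ring) (RtoC x) k) (a k)) n))).
    + intros n; now rewrite Hsum.
    + eapply filterlim_comp; [exact H|].
      apply (@continuous_snd R_UniformSpace R_UniformSpace).
Qed.

Lemma real_pseries_unique (u v : nat -> R) (f : R -> R) :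
  (forall x, Rabs x < 1 -> is_pseries u x (f x)) ->
  (forall x, Rabs x < 1 -> is_pseries v x (f x)) ->
  forall n, u n = v n.
Proof.
  assert (Hcv : forall w : nat -> R, (forall x, Rabs x < 1 -> is_pseries w x (f x)) ->
    Rbar_lt 0 (CV_radius w)).
  { intros w Hw.
    assert (Hh : Rabs (/ 2) < 1) by (rewrite Rabs_pos_eq; lra).
    destruct (Rbar_lt_le_dec (CV_radius w) (Finite (Rabs (/ 2)))) as [Hlt|Hle].
    - exfalso; apply (CV_disk_outside w (/ 2) Hlt).
      assert (Hs : ex_series (fun n => w n * (/ 2) ^ n)).
      { exists (f (/ 2)). apply is_pseries_R, Hw, Hh. }
      now apply ex_series_lim_0.
    - apply Rbar_lt_le_trans with (2 := Hle). simpl. rewrite Rabs_pos_eq; lra. }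
  intros Hu Hv n.
  apply PSeries_ext_recip; [now apply Hcv | now apply Hcv |].
  exists (mkposreal 1 Rlt_0_1); intros x Hx.
  assert (Hx1 : Rabs x < 1).
  { change (Rabs (x + - 0) < 1) in Hx. now rewrite Ropp_0, Rplus_0_r in Hx. }
  rewrite (is_pseries_unique _ _ _ (Hu x Hx1)).
  now rewrite (is_pseries_unique _ _ _ (Hv x Hx1)).
Qed.

Lemma has_expansion_unique (f : C -> C) (a b : nat -> C) :
  has_expansion f a -> has_expansion f b -> forall n, a n = b n.
Proof.
  intros Ha Hb n.
  assert (Hd : forall x, Rabs x < 1 -> in_disk (RtoC x)).
  { intros x Hx; unfold in_disk; now rewrite Cmod_R. }
  apply injective_projections.
  - apply (real_pseries_unique (fun k => fst (a k)) (fun k => fst (b k))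
      (fun x => fst (f (RtoC x)))); intros x Hx.
    + exact (proj1 (is_pseries_fst_snd _ _ _ (Ha _ (Hd x Hx)))).
    + exact (proj1 (is_pseries_fst_snd _ _ _ (Hb _ (Hd x Hx)))).
  - apply (real_pseries_unique (fun k => snd (a k)) (fun k => snd (b k))
      (fun x => snd (f (RtoC x)))); intros x Hx.
    + exact (proj2 (is_pseries_fst_snd _ _ _ (Ha _ (Hd x Hx)))).
    + exact (proj2 (is_pseries_fst_snd _ _ _ (Hb _ (Hd x Hx)))).
Qed.

(* Arbitrary when f has no expansion on the disk, which never happens for
   holomorphic f. *)
Definition coeff (f : C -> C) : nat -> C :=
  epsilon (inhabits (fun _ : nat => RtoC 0)) (has_expansion f).

Lemma coeff_eq (f : C -> C) (a : nat -> C) : has_expansion f a -> coeff f = a.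
Proof.
  intros Ha; apply functional_extensionality.
  apply (has_expansion_unique f); [|exact Ha].
  unfold coeff; apply epsilon_spec; now exists a.
Qed.

Definition weight (n : nat) : R := (INR n + 2) ^ 5 / (INR n + 1).

Definition in_H22 (f : C -> C) : Prop :=
  holomorphic_on_disk f /\
  exists a : nat -> C,
    has_expansion f a /\ ex_series (fun n => weight n * Cmod (a n) ^ 2).

Definition H22_norm (f : C -> C) : R :=
  sqrt (Series (fun n => weight n * Cmod (coeff f n) ^ 2)).

Definition CSeries (u : nat -> C) : C :=
  (Series (fun n => Re (u n)), Series (fun n => Im (u n))).

Definition H22_inner (f g : C -> C) : C :=
  CSeries (fun n => (RtoC (weight n) * coeff f n * Cconj (coeff g n))%C).

Definition sup_norm (f : C -> C) : Rbar :=
  Lub_Rbar (fun r => exists z : C, in_disk z /\ r = Cmod (f z)).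

Definition composition_operator (phi f : C -> C) : C -> C := fun z => f (phi z).

(* An orthonormal family whose finite linear combinations are dense. *)
Definition H22_orthonormal_basis (e : nat -> C -> C) : Prop :=
  (forall n, in_H22 (e n)) /\
  (forall n m, H22_inner (e n) (e m) = RtoC (if Nat.eqb n m then 1 else 0)) /\
  (forall f, in_H22 f -> forall eps : R, 0 < eps ->
     exists (N : nat) (c : nat -> C),
       H22_norm (fun z => (f z - sum_n (fun k => c k * e k z) N)%C) < eps).

(* Linearity and the norm bound force T f and T g to agree on the disk as soon
   as f and g do, so T is an operator on functions on the disk. *)
Definition H22_bounded_operator (T : (C -> C) -> (C -> C)) : Prop :=
  (forall f, in_H22 f -> in_H22 (T f)) /\
  (forall (c : C) (f g : C -> C), in_H22 f -> in_H22 g ->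
     forall z, in_disk z -> T (fun w => (c * f w + g w)%C) z = (c * T f z + T g z)%C) /\
  (exists M : R, forall f, in_H22 f -> H22_norm (T f) <= M * H22_norm f).

Definition H22_Hilbert_Schmidt (T : (C -> C) -> (C -> C)) : Prop :=
  H22_bounded_operator T /\
  exists e : nat -> C -> C,
    H22_orthonormal_basis e /\ ex_series (fun n => H22_norm (T (e n)) ^ 2).

(* Main.v *)
Require Import Defs.
From Stdlib Require Import Reals.
From Stdlib Require Import Arith Lra Lia Psatz FunctionalExtensionality ClassicalEpsilon.
From Coquelicot Require Import Coquelicot.

(* The weights [w n = (n + 2)^5 / (n + 1)] satisfy [w (i + j) <= 32 (w i + w j)] and
   have summable inverses, so H22 is, up to a constant, a Banach algebra whose norm
   dominates the supremum norm.  Hence [||phi ^ n||] is governed by the spectral radius of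
   [phi]: split [phi = p + q] with [p] a Taylor polynomial and [q] of small norm.  The
   Taylor coefficients of [p ^ j], at most [deg p * j + 1] in number, are bounded by
   [(sup |p|) ^ j], so [||p ^ j||] grows like a polynomial in [j] times [(sup |p|) ^ j], and
   an induction on [n] gives [||phi ^ n|| <= K theta ^ n] with [theta < 1].  Writing
   [f o phi = sum b_n phi ^ n] then gives boundedness, and the normalized monomials, an
   orthonormal basis, are mapped to [phi ^ n / sqrt (w n)], whose squared norms are
   summable. *)

(* [sum_n] leaves the carrier of an algebraic structure as the type of an equation,
   which [ring] does not recognize. *)
Ltac ring_in T :=
  match goal with |- @eq _ ?x ?y => refine ((fun H : @eq T x y => H) _); ring end.

(** * Holomorphy of compositions and monomials *)

(** Both module structures carry the same operations and norm, so only the linearity record is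
    rebuilt. The product and chain rules speak of [AbsRing_NormedModule C_AbsRing]. *)
Lemma ex_derive_C_target (f : C -> C) (z : C) :
  @ex_derive C_AbsRing C_NormedModule f z <->
  @ex_derive C_AbsRing (AbsRing_NormedModule C_AbsRing) f z.
Proof.
  split; intros [l [Hlin Hd]]; exists l; split; try exact Hd;
    destruct Hlin as [H1 H2 H3]; constructor; assumption.
Qed.

Lemma holomorphic_on_disk_comp (f g : C -> C) :
  holomorphic_on_disk f -> holomorphic_on_disk g ->
  (forall z, in_disk z -> in_disk (g z)) ->
  holomorphic_on_disk (fun z => f (g z)).
Proof.
  intros Hf Hg Hd z Hz.
  destruct (Hf _ (Hd z Hz)) as [df Hdf].
  destruct (proj1 (ex_derive_C_target _ _) (Hg z Hz)) as [dg Hdg].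
  exact (ex_intro _ _ (is_derive_comp f g z df dg Hdf Hdg)).
Qed.

Lemma holomorphic_on_disk_monomial (c : C) (n : nat) :
  holomorphic_on_disk (fun z => (c * z ^ n)%C).
Proof.
  intros z _. apply ex_derive_C_target.
  induction n as [|n IH].
  - exact (ex_derive_const (V := AbsRing_NormedModule C_AbsRing) (c * 1)%C z).
  - destruct IH as [l Hl].
    eexists.
    apply (is_derive_ext (V := AbsRing_NormedModule C_AbsRing)
      (fun w : C => mult (K := C_AbsRing) w (c * w ^ n)%C)).
    + intros w. unfold mult; simpl. ring.
    + apply (is_derive_mult (K := C_AbsRing) (fun w => w) (fun w => (c * w ^ n)%C)).
      * apply (is_derive_id (K := C_AbsRing)).
      * exact Hl.
      * intros; apply Cmult_comm.
Qed.

(** * Finite sums and limits of complex sequences *)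

Lemma csum_S (u : nat -> C) n : @sum_n C_AbelianMonoid u (S n) = (sum_n u n + u (S n))%C.
Proof. exact (sum_Sn u n). Qed.

Lemma rsum_S (u : nat -> R) n : sum_n u (S n) = sum_n u n + u (S n).
Proof. exact (sum_Sn u n). Qed.

Lemma csum_O (u : nat -> C) : @sum_n C_AbelianMonoid u 0 = u 0%nat.
Proof. exact (sum_O u). Qed.

Lemma Cpow_n (z : C) n : pow_n (K := C_Ring) z n = (z ^ n)%C.
Proof. induction n as [|n IH]; [reflexivity|]. simpl. rewrite IH. reflexivity. Qed.

Definition cconv (u : nat -> C) (l : C) : Prop :=
  forall eps, 0 < eps -> exists N, forall n, (N <= n)%nat -> Cmod (u n - l)%C < eps.

Lemma cconv_filterlim (u : nat -> C) (l : C) :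
  cconv u l <-> filterlim u eventually (@locally C_UniformSpace l).
Proof.
  rewrite (filterlim_locally_ball_norm (U := C_NormedModule)).
  split.
  - intros H eps. exact (H eps (cond_pos eps)).
  - intros H eps He. exact (H (mkposreal eps He)).
Qed.

Lemma has_expansion_cconv (f : C -> C) (a : nat -> C) :
  has_expansion f a <->
  forall z, in_disk z -> cconv (fun n => sum_n (fun k => z ^ k * a k)%C n) (f z).
Proof.
  unfold has_expansion, is_pseries, is_series.
  split; intros H z Hz; specialize (H z Hz).
  - apply cconv_filterlim. eapply filterlim_ext; [|exact H].
    intros n. apply sum_n_ext; intros k. rewrite <- Cpow_n. reflexivity.
  - apply cconv_filterlim in H. eapply filterlim_ext; [|exact H].
    intros n. apply sum_n_ext; intros k. rewrite <- Cpow_n. reflexivity.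
Qed.

Lemma Cmod_csum (u : nat -> C) n : Cmod (sum_n u n) <= sum_n (fun k => Cmod (u k)) n.
Proof. exact (norm_sum_n_m (V := C_NormedModule) u 0 n). Qed.

Lemma csum_mult_l (c : C) (u : nat -> C) n :
  (c * sum_n u n)%C = sum_n (fun k => (c * u k)%C) n.
Proof. symmetry. exact (sum_n_mult_l (K := C_Ring) c u n). Qed.

Lemma rsum_le (u v : nat -> R) n :
  (forall k, (k <= n)%nat -> u k <= v k) -> sum_n u n <= sum_n v n.
Proof.
  induction n as [|n IH]; intros H.
  - rewrite !sum_O. now apply H.
  - rewrite !rsum_S. apply Rplus_le_compat; [apply IH; intros; apply H; lia | now apply H].
Qed.

Lemma rsum_ge_0 (u : nat -> R) n : (forall k, 0 <= u k) -> 0 <= sum_n u n.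
Proof.
  intros H. induction n as [|n IH]; [rewrite sum_O; apply H|].
  rewrite rsum_S. specialize (H (S n)). lra.
Qed.

Lemma rsum_incr (u : nat -> R) n m :
  (forall k, 0 <= u k) -> (n <= m)%nat -> sum_n u n <= sum_n u m.
Proof.
  intros H Hnm. induction Hnm as [|m _ IH]; [lra|].
  rewrite rsum_S. specialize (H (S m)). lra.
Qed.

Lemma rsum_term (u : nat -> R) n k :
  (forall k, 0 <= u k) -> (k <= n)%nat -> u k <= sum_n u n.
Proof.
  intros H Hk. apply Rle_trans with (sum_n u k); [|now apply rsum_incr].
  destruct k; [rewrite sum_O; lra|]. rewrite rsum_S.
  pose proof (rsum_ge_0 u k H). lra.
Qed.

Lemma rsum_scal (c : R) (u : nat -> R) n :
  sum_n (fun k => c * u k) n = c * sum_n u n.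
Proof. exact (sum_n_mult_l (K := R_Ring) c u n). Qed.

Lemma rsum_plus (u v : nat -> R) n :
  sum_n (fun k => u k + v k) n = sum_n u n + sum_n v n.
Proof. exact (sum_n_plus u v n). Qed.

Lemma rsum_geom (q : R) n : (1 - q) * sum_n (fun k => q ^ k) n = 1 - q ^ S n.
Proof.
  induction n as [|n IH].
  - rewrite sum_O. simpl. ring.
  - rewrite rsum_S, Rmult_plus_distr_l, IH. simpl. ring.
Qed.

Lemma rsum_geom_le (q : R) n : 0 <= q < 1 -> sum_n (fun k => q ^ k) n <= / (1 - q).
Proof.
  intros Hq. apply Rmult_le_reg_l with (1 - q); [lra|].
  rewrite rsum_geom, Rinv_r by lra.
  pose proof (pow_le q (S n) (proj1 Hq)). lra.
Qed.

Lemma pow_lt_eps (q eps : R) : 0 <= q < 1 -> 0 < eps ->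
  exists N, forall n, (N <= n)%nat -> q ^ n < eps.
Proof.
  intros Hq He.
  destruct (pow_lt_1_zero q) with (y := eps) as [N HN]; auto.
  { rewrite Rabs_pos_eq; lra. }
  exists N. intros n Hn. eapply Rle_lt_trans; [apply Rle_abs|]. now apply HN.
Qed.

Lemma cconv_unique (u : nat -> C) l l' : cconv u l -> cconv u l' -> l = l'.
Proof.
  intros H H'.
  apply cconv_filterlim in H. apply cconv_filterlim in H'.
  exact (filterlim_locally_unique (V := C_NormedModule) u l l' H H').
Qed.

Lemma cconv_Cmod_le (u : nat -> C) l (B : R) :
  cconv u l -> (exists N, forall n, (N <= n)%nat -> Cmod (u n) <= B) -> Cmod l <= B.
Proof.
  intros H [N0 HB]. apply le_epsilon. intros eps He.
  destruct (H eps He) as [N HN].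
  specialize (HN (max N N0) ltac:(lia)). specialize (HB (max N N0) ltac:(lia)).
  replace l with (u (max N N0) - (u (max N N0) - l))%C by ring.
  eapply Rle_trans; [apply Cmod_triangle|]. rewrite Cmod_opp. lra.
Qed.

Lemma cconv_const (c : C) : cconv (fun _ => c) c.
Proof.
  intros eps He. exists 0%nat. intros n _.
  replace (c - c)%C with (RtoC 0) by ring. now rewrite Cmod_0.
Qed.

Lemma cconv_ext_loc (u v : nat -> C) l :
  (exists N, forall n, (N <= n)%nat -> u n = v n) -> cconv u l -> cconv v l.
Proof.
  intros [N HN] H eps He. destruct (H eps He) as [N' H']. exists (max N N').
  intros n Hn. rewrite <- HN by lia. apply H'; lia.
Qed.

Lemma cconv_plus (u v : nat -> C) l m :
  cconv u l -> cconv v m -> cconv (fun n => (u n + v n)%C) (l + m)%C.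
Proof.
  intros Hu Hv eps He.
  destruct (Hu (eps / 2)) as [N HN]; [lra|]. destruct (Hv (eps / 2)) as [N' HN']; [lra|].
  exists (max N N'). intros n Hn.
  replace (u n + v n - (l + m))%C with ((u n - l) + (v n - m))%C by ring.
  eapply Rle_lt_trans; [apply Cmod_triangle|].
  specialize (HN n ltac:(lia)). specialize (HN' n ltac:(lia)). lra.
Qed.

Lemma cconv_mult_l (c : C) (u : nat -> C) l :
  cconv u l -> cconv (fun n => (c * u n)%C) (c * l)%C.
Proof.
  intros H eps He. pose proof (Cmod_ge_0 c) as Hc.
  destruct (H (eps / (Cmod c + 1))) as [N HN]; [apply Rdiv_lt_0_compat; lra|].
  exists N. intros n Hn. specialize (HN n Hn).
  replace (c * u n - c * l)%C with (c * (u n - l))%C by ring. rewrite Cmod_mult.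
  apply Rmult_lt_compat_r with (r := Cmod c + 1) in HN; [|lra].
  replace (eps / (Cmod c + 1) * (Cmod c + 1)) with eps in HN by (field; lra).
  pose proof (Cmod_ge_0 (u n - l)%C). nra.
Qed.

Lemma cconv_sum (u : nat -> nat -> C) (l : nat -> C) m :
  (forall k, cconv (fun n => u n k) (l k)) ->
  cconv (fun n => sum_n (u n) m) (sum_n l m).
Proof.
  intros H. induction m as [|m IH].
  - rewrite csum_O. eapply cconv_ext_loc; [|exact (H 0%nat)].
    exists 0%nat. intros n _. now rewrite csum_O.
  - rewrite csum_S. eapply cconv_ext_loc; [|exact (cconv_plus _ _ _ _ IH (H (S m)))].
    exists 0%nat. intros n _. now rewrite csum_S.
Qed.

(** * Power series expansions on the disk *)

(** Comparison with a geometric tail. The bound depends on the coefficients only through [M], hence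
    is uniform over a family of series. *)
Lemma csum_tail_le (s : nat -> C) (M : R) (z : C) m n :
  (forall k, Cmod (s k) <= M) -> in_disk z -> (m <= n)%nat ->
  Cmod (sum_n (fun k => z ^ k * s k)%C n - sum_n (fun k => z ^ k * s k)%C m)%C
    <= M * (/ (1 - Cmod z)) * Cmod z ^ m.
Proof.
  intros Hs Hz Hmn. unfold in_disk in Hz. pose proof (Cmod_ge_0 z) as Hz0.
  assert (HM : 0 <= M) by (eapply Rle_trans; [apply Cmod_ge_0 | apply (Hs 0%nat)]).
  set (q := Cmod z) in *.
  (* Multiplying by [1 - q] makes the geometric sum telescope, so the induction involves no
     division. *)
  assert (H : (1 - q) * Cmod (sum_n (fun k => z ^ k * s k)%C n - sum_n (fun k => z ^ k * s k)%C m)%C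
     <= M * (q ^ S m - q ^ S n)).
  { induction Hmn as [|n Hmn IH].
    - replace (_ - _)%C with (RtoC 0) by ring. rewrite Cmod_0. lra.
    - rewrite csum_S.
      replace (_ + _ - _)%C with ((sum_n (fun k => z ^ k * s k)%C n
        - sum_n (fun k => z ^ k * s k)%C m) + z ^ S n * s (S n))%C by ring.
      pose proof (Cmod_triangle (sum_n (fun k => z ^ k * s k)%C n
        - sum_n (fun k => z ^ k * s k)%C m) (z ^ S n * s (S n))) as HT.
      rewrite Cmod_mult, Cmod_pow in HT. fold q in HT.
      specialize (Hs (S n)).
      pose proof (pow_le q (S n) Hz0) as Hp.
      assert (q ^ S n * Cmod (s (S n)) <= M * q ^ S n) by nra.
      change (q ^ S (S n)) with (q * q ^ S n). nra. }
  apply Rmult_le_reg_l with (1 - q); [lra|].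
  eapply Rle_trans; [exact H|].
  replace ((1 - q) * (M * / (1 - q) * q ^ m)) with (M * q ^ m) by (field; lra).
  apply Rmult_le_compat_l; [exact HM|].
  pose proof (pow_le q (S n) Hz0). pose proof (pow_le q m Hz0).
  change (q ^ S m) with (q * q ^ m). nra.
Qed.

(* Uniformly bounded coefficients give tails that are uniformly small on
   compact subsets of the disk, which allows the limit to be taken termwise. *)
Lemma has_expansion_limit (F : nat -> C -> C) (s : nat -> nat -> C) (f : C -> C)
    (c : nat -> C) (M : R) :
  (forall N, has_expansion (F N) (s N)) ->
  (forall N k, Cmod (s N k) <= M) ->
  (forall k, cconv (fun N => s N k) (c k)) ->
  (forall z, in_disk z -> cconv (fun N => F N z) (f z)) ->
  has_expansion f c.
Proof.
  intros HF HM Hc Hf. apply has_expansion_cconv. intros z Hz.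
  pose proof (Cmod_ge_0 z) as Hz0. pose proof Hz as Hz1. unfold in_disk in Hz1.
  assert (HM0 : 0 <= M) by (eapply Rle_trans; [apply Cmod_ge_0 | apply (HM 0 0)%nat]).
  set (B := M * / (1 - Cmod z)).
  assert (HB : 0 <= B).
  { apply Rmult_le_pos; [exact HM0|]. apply Rlt_le, Rinv_0_lt_compat; lra. }
  (* Two limits in turn: first the partial sums of [F N] with [N] fixed, then [N] to infinity with
     [m] fixed. The second is harmless because the bound does not involve [N]. *)
  assert (H1 : forall N m, Cmod (F N z - sum_n (fun k => z ^ k * s N k)%C m)%C
     <= B * Cmod z ^ m).
  { intros N m.
    apply cconv_Cmod_le with (u := fun n => (sum_n (fun k => z ^ k * s N k)%C n
       - sum_n (fun k => z ^ k * s N k)%C m)%C).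
    - apply cconv_plus; [|apply cconv_const].
      now apply has_expansion_cconv.
    - exists m. intros n Hn. now apply csum_tail_le. }
  assert (H2 : forall m, Cmod (f z - sum_n (fun k => z ^ k * c k)%C m)%C
     <= B * Cmod z ^ m).
  { intros m.
    apply cconv_Cmod_le with (u := fun N => (F N z - sum_n (fun k => z ^ k * s N k)%C m)%C).
    - apply cconv_plus; [now apply Hf|].
      replace (- sum_n (fun k => z ^ k * c k)%C m)%C
        with ((-(1)) * sum_n (fun k => z ^ k * c k)%C m)%C by ring.
      eapply cconv_ext_loc; [|apply cconv_mult_l, cconv_sum; intros k;
        apply cconv_mult_l, Hc].
      exists 0%nat. intros n _. cbv beta. ring.
    - exists 0%nat. intros N _. apply H1. }
  intros eps He.
  (* The divisor is [B + 1] because [B] may vanish. *)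
  destruct (pow_lt_eps (Cmod z) (eps / (B + 1))) as [N HN]; [lra | apply Rdiv_lt_0_compat; lra |].
  exists N. intros n Hn. specialize (HN n Hn). specialize (H2 n).
  replace (_ - _)%C with (- (f z - sum_n (fun k => z ^ k * c k) n))%C by ring.
  rewrite Cmod_opp.
  apply Rmult_lt_compat_r with (r := B + 1) in HN; [|lra].
  replace (eps / (B + 1) * (B + 1)) with eps in HN by (field; lra).
  pose proof (pow_le (Cmod z) n Hz0). nra.
Qed.

Lemma has_expansion_ext f g a b : (forall z, in_disk z -> f z = g z) ->
  (forall k, a k = b k) -> has_expansion f a -> has_expansion g b.
Proof.
  intros H Hab Ha z Hz. rewrite <- H by exact Hz.
  replace b with a by now apply functional_extensionality. now apply Ha.
Qed.

Lemma has_expansion_plus f g a b : has_expansion f a -> has_expansion g b ->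
  has_expansion (fun z => f z + g z)%C (fun k => a k + b k)%C.
Proof. intros Ha Hb z Hz. exact (is_pseries_plus a b z _ _ (Ha z Hz) (Hb z Hz)). Qed.

Lemma has_expansion_scal c f a : has_expansion f a ->
  has_expansion (fun z => c * f z)%C (fun k => c * a k)%C.
Proof.
  intros Ha z Hz.
  exact (is_pseries_scal (K := C_AbsRing) (V := C_NormedModule) c a z (f z)
    (Cmult_comm z c) (Ha z Hz)).
Qed.

Lemma has_expansion_shift f a j : has_expansion f a ->
  has_expansion (fun z => z ^ j * f z)%C
    (fun k => if (k <? j)%nat then RtoC 0 else a (k - j)%nat).
Proof.
  intros Ha. induction j as [|j IH].
  - intros z Hz. replace (z ^ 0 * f z)%C with (f z) by (simpl; ring).
    replace (fun k => _) with a; [now apply Ha|].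
    apply functional_extensionality; intros k.
    change (k <? 0)%nat with false. now rewrite Nat.sub_0_r.
  - intros z Hz.
    pose proof (is_pseries_incr_1 (K := C_AbsRing) (V := C_NormedModule) _ _ _ (IH z Hz)) as H.
    replace (z ^ S j * f z)%C with (z * (z ^ j * f z))%C by (simpl; ring).
    replace (fun k => if (k <? S j)%nat then RtoC 0 else a (k - S j)%nat)
      with (PS_incr_1 (V := C_NormedModule)
        (fun k => if (k <? j)%nat then RtoC 0 else a (k - j)%nat)); [exact H|].
    apply functional_extensionality; intros [|k]; reflexivity.
Qed.

Lemma has_expansion_finite (a : nat -> C) d :
  has_expansion (fun z => sum_n (fun k => z ^ k * a k)%C d)
    (fun k => if (k <=? d)%nat then a k else RtoC 0).
Proof.
  apply has_expansion_cconv. intros z Hz.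
  eapply cconv_ext_loc; [|apply cconv_const].
  exists d. intros n Hn. induction Hn as [|n Hn IH].
  - apply sum_n_ext_loc. intros k Hk. now rewrite (proj2 (Nat.leb_le k d) Hk).
  - rewrite csum_S, <- IH. rewrite (proj2 (Nat.leb_gt (S n) d)) by lia. now rewrite Cmult_0_r, Cplus_0_r.
Qed.

Definition cauchy_product (a b : nat -> C) (k : nat) : C :=
  sum_n (fun j => b j * a (k - j)%nat)%C k.

(** The sums over [j <= N] of [b j * (z ^ j * f z)] have coefficients bounded by [A * B] whatever
    [N] is, and their coefficient of index [k] is constant from [N = k] on. So [has_expansion_limit]
    applies. *)
Lemma has_expansion_mult f g a b (A B : R) :
  has_expansion f a -> has_expansion g b ->
  (forall k, Cmod (a k) <= A) -> (forall n, sum_n (fun k => Cmod (b k)) n <= B) ->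
  has_expansion (fun z => f z * g z)%C (cauchy_product a b).
Proof.
  intros Ha Hb HA HB.
  assert (HA0 : 0 <= A) by (eapply Rle_trans; [apply Cmod_ge_0 | apply (HA 0%nat)]).
  set (t := fun k j : nat => (b j * (if (k <? j)%nat then RtoC 0 else a (k - j)%nat))%C).
  apply (has_expansion_limit
    (fun N z => sum_n (fun j => b j * (z ^ j * f z))%C N)
    (fun N k => sum_n (t k) N) _ _ (A * B)).
  - intros N. induction N as [|N IH].
    + eapply has_expansion_ext;
        [..|exact (has_expansion_scal (b 0%nat) _ _ (has_expansion_shift f a 0 Ha))].
      * intros z _. now rewrite csum_O.
      * intros k. now rewrite csum_O.
    + eapply has_expansion_ext;
        [..|exact (has_expansion_plus _ _ _ _ IH
              (has_expansion_scal (b (S N)) _ _ (has_expansion_shift f a (S N) Ha)))].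
      * intros z _. now rewrite csum_S.
      * intros k. now rewrite csum_S.
  - intros N k. eapply Rle_trans; [apply Cmod_csum|].
    apply Rle_trans with (A * sum_n (fun j => Cmod (b j)) N);
      [|apply Rmult_le_compat_l; auto].
    rewrite <- rsum_scal. apply rsum_le. intros j _. unfold t.
    rewrite Cmod_mult, Rmult_comm.
    apply Rmult_le_compat_r; [apply Cmod_ge_0|].
    destruct (k <? j)%nat; [now rewrite Cmod_0 | apply HA].
  - intros k. eapply cconv_ext_loc; [|apply cconv_const].
    exists k. intros N HN. induction HN as [|N HN IH].
    + apply sum_n_ext_loc. intros j Hj. unfold t.
      now rewrite (proj2 (Nat.ltb_ge k j) Hj).
    + rewrite csum_S, <- IH. unfold t.
      rewrite (proj2 (Nat.ltb_lt k (S N))) by lia. now rewrite Cmult_0_r, Cplus_0_r.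
  - intros z Hz.
    apply cconv_ext_loc with (u := fun N => (f z * sum_n (fun j => z ^ j * b j)%C N)%C).
    + exists 0%nat. intros N _. rewrite csum_mult_l. apply sum_n_ext. intros j.
      change (f z * (z ^ j * b j) = b j * (z ^ j * f z))%C. ring.
    + apply cconv_mult_l. now apply has_expansion_cconv.
Qed.

(** * Cauchy-Schwarz and sums over triangles *)

(** The cross term satisfies [(2 T t) ^ 2 <= 4 (X y) (x Y) <= (X y + x Y) ^ 2], the comparison of
    geometric and arithmetic means. *)
Lemma cauchy_schwarz_step (T t X Y x y : R) :
  0 <= T -> 0 <= t -> 0 <= X -> 0 <= Y -> 0 <= x -> 0 <= y ->
  T ^ 2 <= X * Y -> t ^ 2 <= x * y -> (T + t) ^ 2 <= (X + x) * (Y + y).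
Proof.
  intros HT Ht HX HY Hx Hy H1 H2.
  assert (H : 2 * (T * t) <= X * y + x * Y).
  { apply Rsqr_incr_0_var.
    - unfold Rsqr.
      assert (T ^ 2 * t ^ 2 <= (X * Y) * (x * y)) by (apply Rmult_le_compat; nra).
      pose proof (pow2_ge_0 (X * y - x * Y)). nra.
    - pose proof (Rmult_le_pos _ _ HX Hy). pose proof (Rmult_le_pos _ _ Hx HY). lra. }
  nra.
Qed.

(** Bounding [t k ^ 2] by [x k * y k] avoids square roots when [x] and [y] contain weights and
    inverse weights. *)
Lemma cauchy_schwarz (t x y : nat -> R) n :
  (forall k, 0 <= t k) -> (forall k, 0 <= x k) -> (forall k, 0 <= y k) ->
  (forall k, (k <= n)%nat -> t k ^ 2 <= x k * y k) ->
  sum_n t n ^ 2 <= sum_n x n * sum_n y n.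
Proof.
  intros Ht Hx Hy. induction n as [|n IH]; intros H.
  - rewrite !sum_O. now apply H.
  - rewrite !rsum_S. apply cauchy_schwarz_step; auto using rsum_ge_0.
Qed.

Lemma rsum_split_first (u : nat -> R) n :
  sum_n u (S n) = u 0%nat + sum_n (fun k => u (S k)) n.
Proof.
  induction n as [|n IH].
  - now rewrite rsum_S, !sum_O.
  - now rewrite rsum_S, IH, rsum_S, Rplus_assoc.
Qed.

Lemma rsum_rev (u : nat -> R) n : sum_n (fun j => u (n - j)%nat) n = sum_n u n.
Proof.
  induction n as [|n IH]; [now rewrite !sum_O|].
  rewrite rsum_split_first, rsum_S, <- IH. apply Rplus_comm.
Qed.

(** The left side sums [B j * A i] over the triangle [i + j <= n], which lies in the square
    [i, j <= n]. *)
Lemma rsum_cauchy_product_le (A B : nat -> R) n :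
  (forall k, 0 <= A k) -> (forall k, 0 <= B k) ->
  sum_n (fun k => sum_n (fun j => B j * A (k - j)%nat) k) n <= sum_n B n * sum_n A n.
Proof.
  intros HA HB.
  (* Padding with zeros gives both indices the fixed range up to [n], so that the sums can be
     exchanged. *)
  set (t := fun k j => if (j <=? k)%nat then B j * A (k - j)%nat else 0).
  rewrite (sum_n_ext_loc _ (fun k => sum_n (t k) n)).
  2:{ intros k Hk. induction Hk as [|n Hk IH].
      - apply sum_n_ext_loc. intros j Hj. unfold t.
        now rewrite (proj2 (Nat.leb_le j k) Hj).
      - rewrite IH, (rsum_S (t k)). unfold t at 3.
        rewrite (proj2 (Nat.leb_gt (S n) k)) by lia. symmetry; apply Rplus_0_r. }
  rewrite (sum_n_switch t).
  rewrite Rmult_comm, <- rsum_scal. apply rsum_le. intros j _.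
  assert (H : forall m, sum_n (fun k => t k j) m
    = if (j <=? m)%nat then B j * sum_n A (m - j) else 0).
  { induction m as [|m IH].
    - rewrite sum_O. unfold t. destruct (Nat.leb_spec j 0); [|reflexivity].
      now rewrite sum_O.
    - rewrite rsum_S, IH. unfold t.
      destruct (Nat.leb_spec j m).
      + rewrite (proj2 (Nat.leb_le j (S m))) by lia.
        replace (S m - j)%nat with (S (m - j)) by lia. rewrite rsum_S.
        symmetry; apply Rmult_plus_distr_l.
      + destruct (Nat.leb_spec j (S m)); [|apply Rplus_0_l].
        replace (S m - j)%nat with 0%nat by lia. rewrite sum_O. apply Rplus_0_l. }
  rewrite H. pose proof (rsum_ge_0 A n HA). specialize (HB j).
  destruct (j <=? n)%nat; [|now apply Rmult_le_pos].
  rewrite Rmult_comm. apply Rmult_le_compat_r; [exact HB|].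
  apply rsum_incr; [exact HA | lia].
Qed.

(** * Estimates for the weights *)

(** A crude bound, chosen because the inverse of its left side telescopes: [1 / ((n + 1) (n + 2)) =
    1 / (n + 1) - 1 / (n + 2)]. *)
Lemma weight_ge n : (INR n + 1) * (INR n + 2) <= weight n.
Proof.
  unfold weight. pose proof (pos_INR n).
  apply Rmult_le_reg_r with (INR n + 1); [lra|].
  replace ((INR n + 2) ^ 5 / (INR n + 1) * (INR n + 1)) with ((INR n + 2) ^ 5) by (field; lra).
  set (x := INR n) in *.
  apply Rle_trans with ((x + 2) * (x + 2) * (x + 2)).
  - apply Rmult_le_compat; nra.
  - replace ((x + 2) ^ 5) with ((x + 2) * (x + 2) * (x + 2) * ((x + 2) * (x + 2))) by ring.
    assert (1 <= (x + 2) * (x + 2)) by nra.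
    assert (0 <= (x + 2) * (x + 2) * (x + 2)) by (repeat apply Rmult_le_pos; lra).
    nra.
Qed.

Lemma weight_ge_1 n : 1 <= weight n.
Proof. pose proof (weight_ge n). pose proof (pos_INR n). nra. Qed.

Lemma weight_pos n : 0 < weight n.
Proof. pose proof (weight_ge_1 n). lra. Qed.

Lemma weight_le n : weight n <= (INR n + 2) ^ 5.
Proof.
  unfold weight. pose proof (pos_INR n).
  assert (0 <= (INR n + 2) ^ 5) by (apply pow_le; lra).
  apply Rmult_le_reg_r with (INR n + 1); [lra|].
  replace ((INR n + 2) ^ 5 / (INR n + 1) * (INR n + 1)) with ((INR n + 2) ^ 5) by (field; lra).
  nra.
Qed.

Lemma sum_inv_weight_le n : sum_n (fun k => / weight k) n <= 1.
Proof.
  (* The telescoped remainder is kept so that the induction goes through. *)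
  assert (H : sum_n (fun k => / weight k) n <= 1 - / (INR n + 2)).
  { induction n as [|n IH].
    - rewrite sum_O. simpl. rewrite Rplus_0_l.
      apply Rle_trans with (/ 2); [|lra].
      pose proof (weight_ge 0). simpl in H. apply Rinv_le_contravar; lra.
    - rewrite rsum_S. pose proof (weight_ge (S n)) as H. rewrite S_INR in *.
      pose proof (pos_INR n).
      apply Rinv_le_contravar in H; [|nra].
      replace (/ ((INR n + 1 + 1) * (INR n + 1 + 2)))
        with (/ (INR n + 2) - / (INR n + 1 + 2)) in H by (field; lra).
      lra. }
  pose proof (pos_INR n).
  assert (0 < / (INR n + 2)) by (apply Rinv_0_lt_compat; lra). lra.
Qed.

(** From [k <= 2 * i] the base [k + 2] is at most twice [i + 2], whence [2 ^ 5 = 32]; from [i <= k]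
    the denominator can only grow. *)
Lemma weight_double i k : (i <= k <= 2 * i)%nat -> weight k <= 32 * weight i.
Proof.
  intros [Hik Hk]. unfold weight.
  apply le_INR in Hik, Hk. rewrite mult_INR in Hk. simpl (INR 2) in Hk.
  pose proof (pos_INR i).
  replace (32 * ((INR i + 2) ^ 5 / (INR i + 1))) with ((2 * (INR i + 2)) ^ 5 / (INR i + 1))
    by (field; lra).
  apply Rmult_le_compat.
  - apply pow_le; lra.
  - left; apply Rinv_0_lt_compat; lra.
  - apply pow_incr; lra.
  - apply Rinv_le_contravar; lra.
Qed.

(** The larger of [i] and [j] is at least half of [i + j]. *)
Lemma weight_add i j : weight (i + j) <= 32 * (weight i + weight j).
Proof.
  pose proof (weight_pos i). pose proof (weight_pos j).
  destruct (Nat.le_ge_cases i j).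
  - pose proof (weight_double j (i + j) ltac:(lia)). lra.
  - pose proof (weight_double i (i + j) ltac:(lia)). lra.
Qed.

(** * Norm bounds and the algebra structure *)

(** Bounding all partial sums makes convergence part of the norm bound. Holomorphy is left out and
    supplied separately for membership. *)
Definition H22_le (f : C -> C) (M : R) : Prop :=
  0 <= M /\ exists a, has_expansion f a /\
    forall n, sum_n (fun k => weight k * Cmod (a k) ^ 2) n <= M ^ 2.

Lemma weighted_square_ge_0 (a : nat -> C) k : 0 <= weight k * Cmod (a k) ^ 2.
Proof. apply Rmult_le_pos; [apply Rlt_le, weight_pos | apply pow2_ge_0]. Qed.

(** Cauchy-Schwarz against the inverse weights; their sum is at most 1, so no constant appears. *)
Lemma sum_Cmod_le (a : nat -> C) (M : R) : 0 <= M ->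
  (forall n, sum_n (fun k => weight k * Cmod (a k) ^ 2) n <= M ^ 2) ->
  forall n, sum_n (fun k => Cmod (a k)) n <= M.
Proof.
  intros HM H n. apply Rsqr_incr_0_var; [|exact HM]. rewrite !Rsqr_pow2.
  eapply Rle_trans.
  - apply cauchy_schwarz with (x := fun k => weight k * Cmod (a k) ^ 2)
      (y := fun k => / weight k).
    + intros; apply Cmod_ge_0.
    + apply weighted_square_ge_0.
    + intros k. apply Rlt_le, Rinv_0_lt_compat, weight_pos.
    + intros k _. right. field. pose proof (weight_pos k); lra.
  - specialize (H n). pose proof (sum_inv_weight_le n) as H1.
    pose proof (rsum_ge_0 _ n (weighted_square_ge_0 a)).
    apply Rle_trans with (sum_n (fun k => weight k * Cmod (a k) ^ 2) n * 1); [|lra].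
    now apply Rmult_le_compat_l.
Qed.

Lemma coef_le (a : nat -> C) (M : R) : 0 <= M ->
  (forall n, sum_n (fun k => weight k * Cmod (a k) ^ 2) n <= M ^ 2) ->
  forall k, Cmod (a k) <= M.
Proof.
  intros HM H k. eapply Rle_trans; [|exact (sum_Cmod_le a M HM H k)].
  apply (rsum_term (fun k => Cmod (a k))); [intros; apply Cmod_ge_0 | lia].
Qed.

Lemma H22_le_pointwise f M z : H22_le f M -> in_disk z -> Cmod (f z) <= M.
Proof.
  intros [HM [a [Ha H]]] Hz. unfold in_disk in Hz.
  apply cconv_Cmod_le with (fun n => sum_n (fun k => z ^ k * a k)%C n).
  - now apply has_expansion_cconv.
  - exists 0%nat. intros n _. eapply Rle_trans; [apply Cmod_csum|].
    eapply Rle_trans; [|exact (sum_Cmod_le a M HM H n)].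
    apply rsum_le. intros k _. rewrite Cmod_mult, Cmod_pow.
    pose proof (Cmod_ge_0 (a k)).
    assert (Cmod z ^ k <= 1 ^ k) by (apply pow_incr; split; [apply Cmod_ge_0|lra]).
    rewrite pow1 in *. nra.
Qed.

(** Minkowski's argument: Cauchy-Schwarz bounds the cross term [T] by [M * L], which completes the
    square [(M + L) ^ 2]. *)
Lemma H22_le_plus f g M L : H22_le f M -> H22_le g L ->
  H22_le (fun z => f z + g z)%C (M + L).
Proof.
  intros [HM [a [Ha HaM]]] [HL [b [Hb HbL]]]. split; [lra|].
  eexists; split; [exact (has_expansion_plus _ _ _ _ Ha Hb)|]. intros n.
  specialize (HaM n). specialize (HbL n).
  set (X := sum_n (fun k => weight k * Cmod (a k) ^ 2) n) in *.
  set (Y := sum_n (fun k => weight k * Cmod (b k) ^ 2) n) in *.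
  set (T := sum_n (fun k => weight k * (Cmod (a k) * Cmod (b k))) n).
  assert (HX : 0 <= X) by apply rsum_ge_0, weighted_square_ge_0.
  assert (HY : 0 <= Y) by apply rsum_ge_0, weighted_square_ge_0.
  assert (Ht : forall k, 0 <= weight k * (Cmod (a k) * Cmod (b k))).
  { intros k. apply Rmult_le_pos; [apply Rlt_le, weight_pos|].
    apply Rmult_le_pos; apply Cmod_ge_0. }
  assert (HT : T <= M * L).
  { apply Rsqr_incr_0_var; [|now apply Rmult_le_pos].
    rewrite !Rsqr_pow2. apply Rle_trans with (X * Y).
    - apply cauchy_schwarz; auto using weighted_square_ge_0.
      intros k _. right. ring.
    - replace ((M * L) ^ 2) with (M ^ 2 * L ^ 2) by ring.
      now apply Rmult_le_compat. }
  apply Rle_trans with (X + Y + 2 * T); [|nra].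
  unfold X, Y, T. rewrite <- rsum_scal, <- !rsum_plus.
  apply rsum_le. intros k _.
  pose proof (weight_pos k). pose proof (Cmod_triangle (a k) (b k)).
  pose proof (Cmod_ge_0 (a k + b k)).
  assert (Cmod (a k + b k) ^ 2 <= (Cmod (a k) + Cmod (b k)) ^ 2)
    by (apply pow_incr; lra).
  nra.
Qed.

Lemma H22_le_scal c f M : H22_le f M -> H22_le (fun z => c * f z)%C (Cmod c * M).
Proof.
  intros [HM [a [Ha H]]]. split; [apply Rmult_le_pos; [apply Cmod_ge_0|exact HM]|].
  eexists; split; [exact (has_expansion_scal c _ _ Ha)|]. intros n. specialize (H n).
  apply Rle_trans with (sum_n (fun k => Cmod c ^ 2 * (weight k * Cmod (a k) ^ 2)) n).
  - apply rsum_le. intros k _. rewrite Cmod_mult. right. ring.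
  - rewrite rsum_scal, Rpow_mult_distr. apply Rmult_le_compat_l; [apply pow2_ge_0|exact H].
Qed.

(* The constant comes from [weight k <= 32 (weight j + weight (k - j))] and the
   sum of the inverse weights being at most 1. *)
Lemma H22_le_mult f g M L : H22_le f M -> H22_le g L ->
  H22_le (fun z => f z * g z)%C (8 * (M * L)).
Proof.
  intros [HM [a [Ha HaM]]] [HL [b [Hb HbL]]].
  split; [pose proof (Rmult_le_pos _ _ HM HL); lra|].
  exists (cauchy_product a b). split.
  { apply has_expansion_mult with M L; auto.
    - now apply coef_le.
    - now apply sum_Cmod_le. }
  intros n.
  set (A := fun k => weight k * Cmod (a k) ^ 2) in *.
  set (B := fun k => weight k * Cmod (b k) ^ 2) in *.
  assert (HA : forall k, 0 <= A k) by apply weighted_square_ge_0.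
  assert (HB : forall k, 0 <= B k) by apply weighted_square_ge_0.
  apply Rle_trans with (64 * (sum_n B n * sum_n A n)).
  - eapply Rle_trans; [|apply Rmult_le_compat_l; [lra|]; now apply rsum_cauchy_product_le].
    rewrite <- rsum_scal. apply rsum_le. intros k _.
    set (v := fun j => / (weight j * weight (k - j))).
    set (u := fun j => B j * A (k - j)%nat).
    (* Here [64 = 32 * (1 + 1)], each of the two sums of inverse weights being at most 1. Its square
       root is the constant 8. *)
    assert (Hv : weight k * sum_n v k <= 64).
    { rewrite <- rsum_scal.
      apply Rle_trans with (32 * (sum_n (fun j => / weight j) k
         + sum_n (fun j => / weight (k - j)) k)).
      - rewrite <- rsum_plus, <- rsum_scal. apply rsum_le. intros j Hj. unfold v.
        pose proof (weight_pos j). pose proof (weight_pos (k - j)).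
        pose proof (weight_add j (k - j)) as H1.
        replace (j + (k - j))%nat with k in H1 by lia.
        replace (32 * (/ weight j + / weight (k - j))) with
          (32 * (weight j + weight (k - j)) * / (weight j * weight (k - j))) by (field; lra).
        apply Rmult_le_compat_r; [|exact H1].
        apply Rlt_le, Rinv_0_lt_compat. nra.
      - rewrite (rsum_rev (fun j => / weight j)).
        pose proof (sum_inv_weight_le k). lra. }
    (* Cauchy-Schwarz with the weights split off: [v j * u j] is the square of the [j]-th term of
       the convolution of moduli. *)
    assert (Hc : Cmod (cauchy_product a b k) ^ 2 <= sum_n v k * sum_n u k).
    { apply Rle_trans with (sum_n (fun j => Cmod (b j) * Cmod (a (k - j)%nat)) k ^ 2).
      - apply pow_incr; split; [apply Cmod_ge_0|].
        eapply Rle_trans; [apply Cmod_csum|].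
        apply rsum_le. intros j _. rewrite Cmod_mult. lra.
      - apply cauchy_schwarz.
        + intros j. apply Rmult_le_pos; apply Cmod_ge_0.
        + intros j. unfold v. apply Rlt_le, Rinv_0_lt_compat, Rmult_lt_0_compat;
            apply weight_pos.
        + intros j. now apply Rmult_le_pos.
        + intros j _. unfold u, v, A, B. right. field.
          split; apply Rgt_not_eq, weight_pos. }
    assert (Hu : 0 <= sum_n u k) by (apply rsum_ge_0; intros; now apply Rmult_le_pos).
    apply Rle_trans with (weight k * (sum_n v k * sum_n u k)).
    + apply Rmult_le_compat_l; [apply Rlt_le, weight_pos | exact Hc].
    + rewrite <- Rmult_assoc. apply Rmult_le_compat_r; assumption.
  - replace ((8 * (M * L)) ^ 2) with (64 * (L ^ 2 * M ^ 2)) by ring.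
    apply Rmult_le_compat_l; [lra|].
    apply Rmult_le_compat; auto using rsum_ge_0.
Qed.

Lemma H22_le_mono f M L : H22_le f M -> M <= L -> H22_le f L.
Proof.
  intros [HM [a [Ha H]]] HML. split; [lra|]. exists a. split; [exact Ha|].
  intros n. eapply Rle_trans; [apply H|]. apply pow_incr; lra.
Qed.

Lemma H22_le_ext f g M : (forall z, in_disk z -> f z = g z) -> H22_le f M -> H22_le g M.
Proof.
  intros H [HM [a [Ha H1]]]. split; [exact HM|]. exists a.
  split; [now apply has_expansion_ext with f a | exact H1].
Qed.

(** * Roots of unity and Cauchy's estimate for polynomials *)

Definition cis (x : R) : C := (cos x, sin x).

Lemma cis_plus x y : (cis x * cis y)%C = cis (x + y).
Proof.
  unfold cis, Cmult; simpl. rewrite cos_plus, sin_plus.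
  apply injective_projections; simpl; ring.
Qed.

Lemma cis_pow x n : (cis x ^ n)%C = cis (INR n * x).
Proof.
  induction n as [|n IH].
  - simpl. unfold cis. now rewrite Rmult_0_l, cos_0, sin_0.
  - rewrite Cpow_S, IH, cis_plus, S_INR. f_equal. ring.
Qed.

Lemma Cmod_cis x : Cmod (cis x) = 1.
Proof.
  unfold Cmod, cis; simpl fst; simpl snd.
  pose proof (sin2_cos2 x) as H. rewrite !Rsqr_pow2 in H.
  rewrite Rplus_comm, H. apply sqrt_1.
Qed.

(** The real part is [1 - 2 sin(x/2) ^ 2], and [sin(x/2)] is positive for [0 < x/2 < PI]. *)
Lemma cis_neq_1 x : 0 < x < 2 * PI -> cis x <> 1.
Proof.
  intros Hx H. apply (f_equal fst) in H. simpl in H.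
  pose proof (sin_gt_0 (x / 2) ltac:(lra) ltac:(lra)) as Hs.
  replace x with (2 * (x / 2)) in H by field.
  rewrite cos_2a_sin in H. nra.
Qed.

Lemma csum_geom (q : C) n : ((1 - q) * sum_n (fun k => q ^ k)%C n)%C = (1 - q ^ S n)%C.
Proof.
  induction n as [|n IH].
  - rewrite csum_O. simpl. ring.
  - rewrite csum_S, Cmult_plus_distr_l, IH. simpl. ring.
Qed.

Lemma csum_zero (u : nat -> C) n : (forall k, (k <= n)%nat -> u k = RtoC 0) ->
  sum_n u n = RtoC 0.
Proof.
  induction n as [|n IH]; intros H.
  - rewrite csum_O. now apply H.
  - rewrite csum_S, IH, H by (intros; try apply H; lia). apply Cplus_0_r.
Qed.

Lemma csum_single (u : nat -> C) n m : (m <= n)%nat ->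
  (forall k, (k <= n)%nat -> k <> m -> u k = RtoC 0) -> sum_n u n = u m.
Proof.
  induction n as [|n IH]; intros Hm H.
  - replace m with 0%nat by lia. apply csum_O.
  - rewrite csum_S. destruct (Nat.eq_dec m (S n)) as [->|Hne].
    + rewrite csum_zero by (intros; apply H; lia). apply Cplus_0_l.
    + rewrite IH by (try lia; intros; apply H; lia).
      rewrite (H (S n)) by lia. apply Cplus_0_r.
Qed.

Lemma csum_const (c : C) n : sum_n (fun _ => c) n = (RtoC (INR (S n)) * c)%C.
Proof.
  induction n as [|n IH].
  - rewrite csum_O. simpl. ring.
  - rewrite csum_S, IH, (S_INR (S n)), RtoC_plus. ring_in C.
Qed.

Lemma has_expansion_polynomial f a d z :
  has_expansion f a -> (forall k, (d < k)%nat -> a k = RtoC 0) -> in_disk z ->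
  f z = sum_n (fun k => z ^ k * a k)%C d.
Proof.
  intros Ha Hd Hz.
  apply cconv_unique with (fun n => sum_n (fun k => z ^ k * a k)%C n).
  - now apply has_expansion_cconv.
  - eapply cconv_ext_loc; [|apply cconv_const]. exists d.
    intros n Hn. induction Hn as [|n Hn IH]; [reflexivity|].
    rewrite csum_S, <- IH, Hd by lia. now rewrite Cmult_0_r, Cplus_0_r.
Qed.

(** This is the passage [rho -> 1] in Cauchy's estimate. The induction replaces one factor [rho] by
    an independent [s]; the power of the larger of the two dominates the mixed product. *)
Lemma le_of_pow_mult_le (A B : R) m : 0 <= A -> 0 <= B ->
  (forall rho, 0 < rho < 1 -> rho ^ m * A <= B) -> A <= B.
Proof.
  intros HA HB. revert A HA. induction m as [|m IH]; intros A HA H.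
  - specialize (H (/ 2) ltac:(lra)). simpl in H. lra.
  - assert (H1 : forall s, 0 < s < 1 -> s * A <= B).
    { intros s Hs. apply IH; [nra|]. intros rho Hr.
      destruct (Rle_dec s rho) as [Hle|Hgt].
      - eapply Rle_trans; [|exact (H rho Hr)]. simpl.
        rewrite (Rmult_comm rho), Rmult_assoc.
        apply Rmult_le_compat_l; [apply pow_le; lra | nra].
      - eapply Rle_trans; [|exact (H s Hs)]. simpl.
        rewrite (Rmult_comm s (s ^ m)), Rmult_assoc.
        apply Rmult_le_compat_r; [nra | apply pow_incr; lra]. }
    destruct (Rle_dec A B) as [|Hn]; [assumption|exfalso].
    (* For this [s] the product [s * A] is the midpoint of [A] and [B], which exceeds [B] when
       [B < A]. *)
    specialize (H1 ((B + A) / (2 * A))).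
    assert (E : (B + A) / (2 * A) * A = (B + A) / 2) by (field; lra).
    rewrite E in H1.
    assert ((B + A) / 2 <= B); [|lra]. apply H1. split.
    + apply Rdiv_lt_0_compat; lra.
    + apply Rmult_lt_reg_r with A; lra.
Qed.

(* Cauchy's estimate, by averaging over the [d + 1]-st roots of unity. *)
Lemma polynomial_coef_le f a d (B : R) m :
  has_expansion f a -> (forall k, (d < k)%nat -> a k = RtoC 0) ->
  (forall z, in_disk z -> Cmod (f z) <= B) -> Cmod (a m) <= B.
Proof.
  intros Ha Hd HB.
  assert (HB0 : 0 <= B).
  { eapply Rle_trans; [apply Cmod_ge_0 | apply (HB 0)]. unfold in_disk. rewrite Cmod_0. lra. }
  destruct (le_lt_dec m d) as [Hm|Hm]; [|rewrite Hd by exact Hm; now rewrite Cmod_0].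
  set (N := S d).
  assert (HN : 0 < INR N) by (apply lt_0_INR; unfold N; lia).
  set (x := 2 * PI / INR N).
  assert (HNx : INR N * x = 2 * PI) by (unfold x; field; lra).
  pose proof PI_RGT_0 as HPI.
  assert (Hx : 0 < x) by (unfold x; apply Rdiv_lt_0_compat; lra).
  assert (H1 : cis (2 * PI) = 1) by (unfold cis; now rewrite cos_2PI, sin_2PI).
  (* The exponent [k - m] will be written [k + (N - m)]: a natural number strictly between 0 and
     [2 * N], equal to [N] exactly when [k = m]. *)
  assert (Hroot : forall l, (0 < l < 2 * N)%nat -> l <> N -> cis (INR l * x) <> 1).
  { intros l Hl HlN H.
    destruct (lt_dec l N) as [Hlt|Hge].
    - revert H. apply cis_neq_1. rewrite <- HNx. split.
      + apply Rmult_lt_0_compat; [apply lt_0_INR; lia | exact Hx].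
      + apply Rmult_lt_compat_r; [exact Hx | apply lt_INR; lia].
    - replace l with (l - N + N)%nat in H by lia.
      rewrite plus_INR, Rmult_plus_distr_r, HNx, <- cis_plus, H1, Cmult_1_r in H.
      revert H. apply cis_neq_1. rewrite <- HNx. split.
      + apply Rmult_lt_0_compat; [apply lt_0_INR; lia | exact Hx].
      + apply Rmult_lt_compat_r; [exact Hx | apply lt_INR; lia]. }
  set (z := fun k => cis (INR (k + (N - m)) * x)).
  (* Orthogonality of characters: [z k] is 1 for [k = m]; otherwise [z k ^ N = 1] with [z k <> 1],
     and the geometric sum vanishes. *)
  assert (Hz : forall k, (k <= d)%nat ->
    sum_n (fun j => z k ^ j)%C d = if Nat.eq_dec k m then RtoC (INR N) else RtoC 0).
  { intros k Hk. destruct (Nat.eq_dec k m) as [->|Hne].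
    - rewrite (sum_n_ext _ (fun _ => RtoC 1)).
      + rewrite csum_const. apply Cmult_1_r.
      + intros j. unfold z. replace (m + (N - m))%nat with N by (unfold N; lia).
        rewrite HNx, H1. apply Cpow_1_l.
    - pose proof (csum_geom (z k) d) as HG.
      assert (HzN : (z k ^ S d)%C = 1).
      { unfold z. rewrite <- cis_pow, <- Cpow_mult_r, Nat.mul_comm, Cpow_mult_r.
        fold N. rewrite cis_pow, HNx, H1. apply Cpow_1_l. }
      rewrite HzN in HG.
      assert (Hz1 : (1 - z k)%C <> 0).
      { intros E. apply (Hroot (k + (N - m))%nat); [unfold N; lia | unfold N; lia |].
        fold (z k). replace (z k) with (1 - (1 - z k))%C by ring. rewrite E. ring. }
      replace (1 - 1)%C with (RtoC 0) in HG by ring.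
      rewrite <- (Cmult_1_l (sum_n _ d)), <- (Cinv_l (1 - z k)%C Hz1), <- Cmult_assoc, HG.
      apply Cmult_0_r. }
  (* The averaging circle has radius [rho < 1], as [f] is bounded only on the open disk. *)
  apply le_of_pow_mult_le with m; [apply Cmod_ge_0 | exact HB0 |].
  intros rho Hrho.
  set (w := fun j => (RtoC rho * cis x ^ j)%C).
  assert (Hwd : forall j, in_disk (w j)).
  { intros j. unfold in_disk, w.
    rewrite Cmod_mult, Cmod_pow, Cmod_cis, pow1, Cmod_R, Rabs_pos_eq; lra. }
  (* Since [cis x ^ N = 1], the factor [cis x ^ (j * (N - m))] inverts [cis x ^ (j * m)]: the sum is
     a discrete Fourier coefficient of [f] on the circle. *)
  assert (E : sum_n (fun j => (cis x ^ (j * (N - m)) * f (w j))%C) d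
    = (RtoC (INR N) * (RtoC (rho ^ m) * a m))%C).
  { rewrite (sum_n_ext _ (fun j => sum_n (fun k =>
      (RtoC (rho ^ k) * a k * z k ^ j)%C) d)).
    2:{ intros j. rewrite (has_expansion_polynomial f a d (w j) Ha Hd (Hwd j)).
        rewrite csum_mult_l. apply sum_n_ext. intros k. unfold w, z.
        rewrite Cpow_mult_l, <- cis_pow, <- !Cpow_mult_r, RtoC_pow.
        rewrite Nat.mul_add_distr_r, Cpow_add_r.
        rewrite (Nat.mul_comm k j), (Nat.mul_comm (N - m) j).
        ring_in C. }
    rewrite (sum_n_switch (fun j k => (RtoC (rho ^ k) * a k * z k ^ j)%C)).
    rewrite (sum_n_ext_loc _ (fun k => (RtoC (rho ^ k) * a k *
      (if Nat.eq_dec k m then RtoC (INR N) else RtoC 0))%C)).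
    2:{ intros k Hk. rewrite <- csum_mult_l. now rewrite Hz. }
    rewrite (csum_single _ d m Hm).
    - destruct (Nat.eq_dec m m); [ring_in C | contradiction].
    - intros k _ Hne. destruct (Nat.eq_dec k m); [contradiction | ring_in C]. }
  apply (f_equal Cmod) in E.
  rewrite !Cmod_mult, !Cmod_R, !Rabs_pos_eq in E by (try apply pow_le; lra).
  apply Rmult_le_reg_l with (INR N); [exact HN|]. rewrite <- E.
  eapply Rle_trans; [apply Cmod_csum|].
  apply Rle_trans with (sum_n (fun _ => B) d).
  - apply rsum_le. intros j _. rewrite Cmod_mult, Cmod_pow, Cmod_cis, pow1, Rmult_1_l.
    apply HB, Hwd.
  - rewrite sum_n_const. apply Rle_refl.
Qed.

(** * Powers of polynomials *)

Lemma cauchy_product_support (a b : nat -> C) d e :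
  (forall k, (d < k)%nat -> a k = RtoC 0) -> (forall k, (e < k)%nat -> b k = RtoC 0) ->
  forall k, (d + e < k)%nat -> cauchy_product a b k = RtoC 0.
Proof.
  intros Ha Hb k Hk. apply csum_zero. intros j Hj.
  destruct (le_lt_dec j e).
  - rewrite Ha by lia. apply Cmult_0_r.
  - rewrite Hb by lia. apply Cmult_0_l.
Qed.

Lemma rsum_support_le (u : nat -> R) d : (forall k, 0 <= u k) ->
  (forall k, (d < k)%nat -> u k = 0) -> forall n, sum_n u n <= sum_n u d.
Proof.
  intros Hu Hd n. destruct (le_lt_dec n d) as [|Hn]; [now apply rsum_incr|].
  apply Nat.lt_le_incl in Hn. induction Hn as [|n Hn IH]; [apply Rle_refl|].
  rewrite rsum_S, Hd by lia. lra.
Qed.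

Lemma polynomial_power (f : C -> C) a d j :
  has_expansion f a -> (forall k, (d < k)%nat -> a k = RtoC 0) ->
  exists b, has_expansion (fun z => f z ^ j)%C b /\
    forall k, (d * j < k)%nat -> b k = RtoC 0.
Proof.
  intros Ha Hd. induction j as [|j [b [Hb Hbd]]].
  - exists (fun k => if (k <=? 0)%nat then RtoC 1 else RtoC 0). split.
    + eapply has_expansion_ext; [..|exact (has_expansion_finite (fun _ => RtoC 1) 0)].
      * intros z _. cbv beta. rewrite csum_O. simpl. ring.
      * reflexivity.
    + intros [|k] Hk; [lia | reflexivity].
  - exists (cauchy_product a b). split.
    + assert (Ha0 : forall k, 0 <= Cmod (a k)) by (intros; apply Cmod_ge_0).
      assert (Hb0 : forall k, 0 <= Cmod (b k)) by (intros; apply Cmod_ge_0).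
      apply (has_expansion_mult f (fun z => f z ^ j)%C a b
        (sum_n (fun k => Cmod (a k)) d) (sum_n (fun k => Cmod (b k)) (d * j))); auto.
      * intros k. apply Rle_trans with (sum_n (fun k => Cmod (a k)) k).
        -- now apply (rsum_term (fun k => Cmod (a k))).
        -- apply rsum_support_le; auto. intros i Hi. rewrite Hd by exact Hi. apply Cmod_0.
      * apply rsum_support_le; auto. intros i Hi. rewrite Hbd by exact Hi. apply Cmod_0.
    + intros k Hk. apply (cauchy_product_support a b d (d * j)); auto. lia.
Qed.

(** With [e = d * j], there are [e + 1] coefficients, each at most [B ^ j] by Cauchy's estimate,
    with weights at most [(e + 2) ^ 5]. The squared norm is thus at most [(e + 2) ^ 6 (B ^ j) ^ 2],
    whence the cube. *)
Lemma H22_le_polynomial_power (f : C -> C) a d j (B : R) :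
  has_expansion f a -> (forall k, (d < k)%nat -> a k = RtoC 0) ->
  (forall z, in_disk z -> Cmod (f z) <= B) ->
  H22_le (fun z => f z ^ j)%C ((INR (d * j) + 2) ^ 3 * B ^ j).
Proof.
  intros Ha Hd HB.
  assert (HB0 : 0 <= B).
  { eapply Rle_trans; [apply Cmod_ge_0 | apply (HB 0)]. unfold in_disk. rewrite Cmod_0. lra. }
  destruct (polynomial_power f a d j Ha Hd) as [b [Hb Hbd]].
  set (e := (d * j)%nat) in *. pose proof (pos_INR e) as He.
  split; [apply Rmult_le_pos; apply pow_le; lra|].
  exists b. split; [exact Hb|]. intros n.
  assert (Hbk : forall k, Cmod (b k) <= B ^ j).
  { intros k. apply (polynomial_coef_le _ b e _ k Hb Hbd).
    intros z Hz. rewrite Cmod_pow. apply pow_incr. split; [apply Cmod_ge_0 | now apply HB]. }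
  eapply Rle_trans.
  { apply rsum_support_le with (d := e); [apply weighted_square_ge_0|].
    intros k Hk. rewrite Hbd by exact Hk. rewrite Cmod_0. ring. }
  apply Rle_trans with (sum_n (fun _ => (INR e + 2) ^ 5 * (B ^ j) ^ 2) e).
  - apply rsum_le. intros k Hk. apply Rmult_le_compat.
    + apply Rlt_le, weight_pos.
    + apply pow2_ge_0.
    + eapply Rle_trans; [apply weight_le|]. apply le_INR in Hk.
      pose proof (pos_INR k). apply pow_incr; lra.
    + apply pow_incr. split; [apply Cmod_ge_0 | apply Hbk].
  - rewrite sum_n_const, S_INR.
    replace (((INR e + 2) ^ 3 * B ^ j) ^ 2) with ((INR e + 2) * ((INR e + 2) ^ 5 * (B ^ j) ^ 2)) by ring.
    apply Rmult_le_compat_r; [|lra].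
    apply Rmult_le_pos; [apply pow_le; lra | apply pow2_ge_0].
Qed.

(** * Geometric bound for the powers of [phi] *)

(** Bernoulli's inequality bounds the linear factor by a multiple of [(1 + s) ^ j], with [s] so
    small that [(1 + s) ^ 3 * R0 <= R1]. *)
Lemma cubic_mult_pow_le (d : nat) (R0 R1 : R) : 0 <= R0 -> R0 < R1 -> R1 <= 1 ->
  exists K, 0 <= K /\ forall j, (INR (d * j) + 2) ^ 3 * R0 ^ j <= K * R1 ^ j.
Proof.
  (* The 7 comes from [(1 + s) ^ 3 <= 1 + 7 s] for [s <= 1]; as [R0 <= 1], it gives
     [(1 + 7 s) R0 <= R0 + 7 s = R1]. *)
  intros H0 H01 H1. set (s := (R1 - R0) / 7).
  assert (Hs : 0 < s <= 1) by (unfold s; lra).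
  exists (((INR d + 2) / s) ^ 3). pose proof (pos_INR d) as Hd.
  assert (Hds : 0 <= (INR d + 2) / s) by (apply Rlt_le, Rdiv_lt_0_compat; lra).
  split; [now apply pow_le|]. intros j. pose proof (pos_INR j) as Hj.
  assert (HA : INR (d * j) + 2 <= (INR d + 2) / s * (1 + s) ^ j).
  { pose proof (poly j s (proj1 Hs)) as HP.
    apply Rle_trans with ((INR d + 2) / s * (s * (INR j + 1))).
    - rewrite mult_INR. replace ((INR d + 2) / s * (s * (INR j + 1)))
        with ((INR d + 2) * (INR j + 1)) by (field; lra). nra.
    - apply Rmult_le_compat_l; [exact Hds|]. nra. }
  apply Rle_trans with (((INR d + 2) / s * (1 + s) ^ j) ^ 3 * R0 ^ j).
  - apply Rmult_le_compat_r; [now apply pow_le|]. apply pow_incr.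
    split; [pose proof (pos_INR (d * j)); lra | exact HA].
  - rewrite Rpow_mult_distr, Rmult_assoc. apply Rmult_le_compat_l; [now apply pow_le|].
    rewrite <- pow_mult, Nat.mul_comm, pow_mult, <- Rpow_mult_distr.
    apply pow_incr. split; [apply Rmult_le_pos; [apply pow_le; lra | lra]|].
    replace R1 with (R0 + 7 * s) by (unfold s; field).
    assert ((1 + s) ^ 3 <= 1 + 7 * s) by nra.
    assert (0 <= (1 + s) ^ 3) by (apply pow_le; lra). nra.
Qed.

(** The squared norm of the remainder is a tail of a convergent series. This serves both to split
    [phi] and to prove the density of polynomials. *)
Lemma H22_le_tail f a (M eps : R) : has_expansion f a ->
  (forall n, sum_n (fun k => weight k * Cmod (a k) ^ 2) n <= M) -> 0 < eps ->
  exists d, H22_le (fun z => f z - sum_n (fun k => z ^ k * a k)%C d)%C eps.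
Proof.
  intros Ha HM He. set (S := sum_n (fun k => weight k * Cmod (a k) ^ 2)).
  assert (Hinc : forall n, S n <= S (Datatypes.S n)).
  { intros n. apply rsum_incr; [apply weighted_square_ge_0 | lia]. }
  destruct (ex_finite_lim_seq_incr S M Hinc HM) as [l Hl].
  pose proof (is_lim_seq_incr_compare S l Hl Hinc) as Hle.
  destruct (proj2 (is_lim_seq_spec _ _) Hl (mkposreal (eps ^ 2) (pow_lt _ 2 He))) as [d Hd].
  specialize (Hd d (Nat.le_refl d)). simpl pos in Hd.
  exists d. split; [lra|].
  exists (fun k => if (k <=? d)%nat then RtoC 0 else a k). split.
  { eapply has_expansion_ext; [..|exact (has_expansion_plus _ _ _ _ Ha
      (has_expansion_scal (-(1))%C _ _ (has_expansion_finite a d)))].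
    - intros z _. cbv beta. ring.
    - intros k. cbv beta. destruct (k <=? d)%nat; ring. }
  intros n.
  assert (E : sum_n (fun k => weight k * Cmod (if (k <=? d)%nat then RtoC 0 else a k) ^ 2) n
    = if (n <=? d)%nat then 0 else S n - S d).
  { induction n as [|n IH].
    - rewrite sum_O. simpl Nat.leb. cbv iota. rewrite Cmod_0. ring_in R.
    - rewrite rsum_S, IH.
      destruct (Nat.leb_spec n d) as [Hn|Hn]; destruct (Nat.leb_spec (Datatypes.S n) d); try lia.
      + rewrite Cmod_0. simpl. lra.
      + replace n with d by lia. unfold S. rewrite rsum_S. simpl; lra.
      + unfold S at 3. rewrite rsum_S. fold (S n). simpl; lra. }
  rewrite E. pose proof (pow2_ge_0 eps).
  destruct (n <=? d)%nat; [assumption|].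
  specialize (Hle n). apply Rabs_def2 in Hd. lra.
Qed.

(* The polynomial part [p] of [phi] has powers of norm [O(R1 ^ j)] with [R1] close to
   the supremum of [phi], and multiplication by the remainder [phi - p] has small norm. *)
Lemma H22_le_power phi a (M r : R) : has_expansion phi a ->
  (forall n, sum_n (fun k => weight k * Cmod (a k) ^ 2) n <= M) ->
  0 <= r < 1 -> (forall z, in_disk z -> Cmod (phi z) <= r) ->
  exists K theta, 0 <= K /\ 0 <= theta < 1 /\
    forall n, H22_le (fun z => phi z ^ n)%C (K * theta ^ n).
Proof.
  (* Three steps of [eps] fit between [r] and 1: [r + eps] bounds [p], [r + 2 * eps] absorbs the
     cubic factor, and [r + 3 * eps] is [theta]. *)
  intros Ha HM Hr Hphi. set (eps := (1 - r) / 4).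
  assert (He : 0 < eps) by (unfold eps; lra).
  (* Dividing by 8 offsets the constant of [H22_le_mult], so multiplication by [q] costs a factor
     [eps]. *)
  destruct (H22_le_tail phi a M (eps / 8) Ha HM ltac:(lra)) as [d Hq].
  set (p := fun z => sum_n (fun k => z ^ k * a k)%C d).
  set (q := fun z => (phi z - p z)%C).
  change (H22_le q (eps / 8)) in Hq.
  assert (Hp : forall z, in_disk z -> Cmod (p z) <= r + eps).
  { intros z Hz. replace (p z) with (phi z + - q z)%C by (unfold q; ring).
    eapply Rle_trans; [apply Cmod_triangle|]. rewrite Cmod_opp.
    pose proof (H22_le_pointwise _ _ z Hq Hz). specialize (Hphi z Hz). lra. }
  destruct (cubic_mult_pow_le d (r + eps) (r + 2 * eps)) as [K [HK HKj]];
    [lra | lra | unfold eps; lra |].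
  exists K, (r + 3 * eps). split; [exact HK|]. split; [unfold eps; lra|].
  (* The exponent [j] must stay general: replacing one factor [phi] by [p + q] raises it. The two
     bounds add up through [(r + 2 * eps) + eps = r + 3 * eps]. *)
  assert (H : forall n j, H22_le (fun z => p z ^ j * phi z ^ n)%C
    (K * (r + 2 * eps) ^ j * (r + 3 * eps) ^ n)).
  { induction n as [|n IH]; intros j.
    - apply H22_le_ext with (fun z => p z ^ j)%C; [intros z _; simpl; ring|].
      eapply H22_le_mono.
      + refine (H22_le_polynomial_power p _ d j (r + eps) (has_expansion_finite a d) _ Hp).
        intros k Hk. now rewrite (proj2 (Nat.leb_gt k d) Hk).
      + rewrite Rmult_1_r. apply HKj.
    - apply H22_le_ext with
        (fun z => p z ^ S j * phi z ^ n + q z * (p z ^ j * phi z ^ n))%C.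
      { intros z _. unfold q. simpl. ring. }
      eapply H22_le_mono; [exact (H22_le_plus _ _ _ _ (IH (S j)) (H22_le_mult _ _ _ _ Hq (IH j)))|].
      right. simpl. field. }
  intros n. apply H22_le_ext with (fun z => p z ^ 0 * phi z ^ n)%C.
  - intros z _. simpl. ring.
  - eapply H22_le_mono; [apply H|]. right. simpl. ring.
Qed.

(** * Series of functions with summable norm bounds *)

Lemma is_lim_seq_Cmod (u : nat -> C) l : cconv u l ->
  is_lim_seq (fun n => Cmod (u n)) (Cmod l).
Proof.
  intros H. apply is_lim_seq_spec. intros eps.
  destruct (H eps (cond_pos eps)) as [N HN]. exists N. intros n Hn.
  specialize (HN n Hn). eapply Rle_lt_trans; [|exact HN].
  pose proof (Cmod_triangle (u n - l) l) as H1.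
  pose proof (Cmod_triangle (- (u n - l)) (u n)) as H2.
  rewrite Cmod_opp in H2.
  replace (u n - l + l)%C with (u n) in H1 by ring.
  replace (- (u n - l) + u n)%C with l in H2 by ring.
  apply Rabs_le. lra.
Qed.

Lemma is_lim_seq_weighted_sum (s : nat -> nat -> C) (c : nat -> C) n :
  (forall k, cconv (fun N => s N k) (c k)) ->
  is_lim_seq (fun N => sum_n (fun k => weight k * Cmod (s N k) ^ 2) n)
    (sum_n (fun k => weight k * Cmod (c k) ^ 2) n).
Proof.
  intros H.
  assert (H1 : forall k, is_lim_seq (fun N => weight k * Cmod (s N k) ^ 2)
      (weight k * Cmod (c k) ^ 2)).
  { intros k. apply is_lim_seq_mult'; [apply is_lim_seq_const|].
    pose proof (is_lim_seq_Cmod _ _ (H k)) as Hk. simpl.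
    repeat apply is_lim_seq_mult'; try exact Hk. apply is_lim_seq_const. }
  induction n as [|n IH].
  - rewrite sum_O. eapply is_lim_seq_ext; [|exact (H1 0%nat)].
    intros N. now rewrite sum_O.
  - rewrite rsum_S. eapply is_lim_seq_ext; [|exact (is_lim_seq_plus' _ _ _ _ IH (H1 (S n)))].
    intros N. now rewrite rsum_S.
Qed.

Lemma cconv_sum_of_le (u : nat -> C) (m : nat -> R) (M : R) :
  (forall n, Cmod (u n) <= m n) -> (forall n, sum_n m n <= M) ->
  exists l, cconv (fun N => sum_n u N) l.
Proof.
  intros Hu HM.
  assert (Hm : forall n, 0 <= m n).
  { intros n. eapply Rle_trans; [apply Cmod_ge_0 | apply Hu]. }
  destruct (ex_finite_lim_seq_incr (sum_n m) M) as [l Hl].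
  - intros n. now apply rsum_incr; [|lia].
  - exact HM.
  - destruct (ex_series_le (V := C_CompleteNormedModule) u m Hu) as [c Hc].
    { exists l. exact Hl. }
    exists c. apply cconv_filterlim. exact Hc.
Qed.

(** The triangle inequality bounds every partial sum [P N] by [M]. Its coefficients converge, since
    they are dominated by [m], and [has_expansion_limit] identifies their limits as the coefficients
    of [f]. *)
Lemma H22_le_series (F : nat -> C -> C) (m : nat -> R) (f : C -> C) (M : R) :
  (forall n, H22_le (F n) (m n)) -> (forall n, sum_n m n <= M) ->
  (forall z, in_disk z -> cconv (fun N => sum_n (fun n => F n z) N) (f z)) ->
  H22_le f M.
Proof.
  intros HF HM Hf.
  set (s := fun n => coeff (F n)).
  assert (Hs : forall n, has_expansion (F n) (s n) /\
    forall k, Cmod (s n k) <= m n).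
  { intros n. destruct (HF n) as [Hm [a [Ha Hb]]]. unfold s.
    rewrite (coeff_eq _ _ Ha). split; [exact Ha|]. now apply coef_le. }
  assert (Hm : forall n, 0 <= m n) by (intros n; apply HF).
  assert (HM0 : 0 <= M) by (eapply Rle_trans; [|apply (HM 0%nat)]; now apply rsum_ge_0).
  set (P := fun N z => sum_n (fun n => F n z) N).
  set (t := fun N k => sum_n (fun n => s n k) N).
  assert (HP : forall N, H22_le (P N) (sum_n m N)).
  { induction N as [|N IH].
    - rewrite sum_O. eapply H22_le_ext; [|exact (HF 0%nat)].
      intros z _. unfold P. now rewrite csum_O.
    - rewrite rsum_S. eapply H22_le_ext; [|exact (H22_le_plus _ _ _ _ IH (HF (S N)))].
      intros z _. unfold P. now rewrite csum_S. }
  assert (Ht : forall N, has_expansion (P N) (t N)).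
  { induction N as [|N IH].
    - eapply has_expansion_ext; [..|exact (proj1 (Hs 0%nat))].
      + intros z _. unfold P. now rewrite csum_O.
      + intros k. unfold t. now rewrite csum_O.
    - eapply has_expansion_ext; [..|exact (has_expansion_plus _ _ _ _ IH (proj1 (Hs (S N))))].
      + intros z _. unfold P. now rewrite csum_S.
      + intros k. unfold t. now rewrite csum_S. }
  assert (Hb : forall N n, sum_n (fun k => weight k * Cmod (t N k) ^ 2) n <= M ^ 2).
  { intros N n. destruct (HP N) as [Hm0 [a [Ha Hn]]].
    rewrite (sum_n_ext _ (fun k => weight k * Cmod (a k) ^ 2)).
    - eapply Rle_trans; [apply Hn|]. apply pow_incr. split; [exact Hm0 | apply HM].
    - intros k. now rewrite (has_expansion_unique _ _ _ (Ht N) Ha k). }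
  assert (Hc : forall k, exists l, cconv (fun N => t N k) l).
  { intros k. apply cconv_sum_of_le with m M; [intros n; apply Hs | exact HM]. }
  set (c := fun k => proj1_sig (constructive_indefinite_description _ (Hc k))).
  assert (Hck : forall k, cconv (fun N => t N k) (c k)).
  { intros k. unfold c. apply proj2_sig. }
  split; [exact HM0|]. exists c. split.
  - apply has_expansion_limit with P t M; auto.
    intros N k. now apply coef_le.
  (* Only finitely many coefficients enter for fixed [n], so the bound passes to the limit in
     [N]. *)
  - intros n.
    exact (is_lim_seq_le _ (fun _ => M ^ 2) (Finite _) (Finite _) (fun N => Hb N n)
      (is_lim_seq_weighted_sum t c n Hck) (is_lim_seq_const _)).
Qed.

(** * From partial-sum bounds to the norm *)

Lemma ex_series_bounded (u : nat -> R) (M : R) : (forall k, 0 <= u k) ->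
  (forall n, sum_n u n <= M) -> ex_series u /\ Series u <= M.
Proof.
  intros Hu HM.
  destruct (ex_finite_lim_seq_incr (sum_n u) M) as [l Hl];
    [intros n; now apply rsum_incr; [|lia] | exact HM |].
  assert (Hs : is_series u l) by exact Hl.
  split; [now exists l|]. rewrite (is_series_unique _ _ Hs).
  exact (is_lim_seq_le _ (fun _ => M) (Finite l) (Finite M) HM Hl (is_lim_seq_const _)).
Qed.

Lemma rsum_le_Series (u : nat -> R) n : (forall k, 0 <= u k) -> ex_series u ->
  sum_n u n <= Series u.
Proof.
  intros Hu Hs. apply Series_correct in Hs.
  apply (is_lim_seq_incr_compare (sum_n u) (Series u) Hs).
  intros k. now apply rsum_incr; [|lia].
Qed.

Lemma H22_norm_le f M : H22_le f M -> H22_norm f <= M.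
Proof.
  intros [HM [a [Ha H]]]. unfold H22_norm. rewrite (coeff_eq _ _ Ha).
  rewrite <- (sqrt_pow2 M HM). apply sqrt_le_1_alt.
  now apply ex_series_bounded; [apply weighted_square_ge_0|].
Qed.

(** Membership supplies convergence of the weighted squares; on a divergent series of nonnegative
    terms [Series] has the default value 0. *)
Lemma H22_le_norm f : in_H22 f -> H22_le f (H22_norm f).
Proof.
  intros [_ [a [Ha Hs]]]. split; [apply sqrt_pos|]. exists a. split; [exact Ha|].
  intros n. unfold H22_norm. rewrite (coeff_eq _ _ Ha).
  pose proof (rsum_le_Series _ n (weighted_square_ge_0 a) Hs).
  rewrite pow2_sqrt; [assumption|].
  pose proof (rsum_ge_0 _ n (weighted_square_ge_0 a)). simpl in *. lra.
Qed.

Lemma in_H22_of_le f M : holomorphic_on_disk f -> H22_le f M -> in_H22 f.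
Proof.
  intros Hf [_ [a [Ha H]]]. split; [exact Hf|]. exists a. split; [exact Ha|].
  exact (proj1 (ex_series_bounded _ _ (weighted_square_ge_0 a) H)).
Qed.

(** * The orthonormal basis of normalized monomials *)

Lemma has_expansion_monomial c n :
  has_expansion (fun z => c * z ^ n)%C (fun k => if (k =? n)%nat then c else RtoC 0).
Proof.
  eapply has_expansion_ext;
    [..|exact (has_expansion_finite (fun k => if (k =? n)%nat then c else RtoC 0) n)].
  - intros z _. cbv beta. rewrite (csum_single _ n n); [|lia|].
    + rewrite Nat.eqb_refl. apply Cmult_comm.
    + intros k _ Hk. rewrite (proj2 (Nat.eqb_neq k n) Hk). apply Cmult_0_r.
  - intros k. cbv beta. destruct (Nat.leb_spec k n); [reflexivity|].
    rewrite (proj2 (Nat.eqb_neq k n)) by lia. reflexivity.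
Qed.

Lemma Series_single (c : R) n : Series (fun k => if (k =? n)%nat then c else 0) = c.
Proof.
  apply is_series_unique.
  assert (H : is_lim_seq (sum_n (fun k => if (k =? n)%nat then c else 0)) c);
    [|exact H].
  apply is_lim_seq_ext_loc with (fun _ => c); [|apply is_lim_seq_const].
  exists n. intros m Hm.
  assert (E : forall m, sum_n (fun k => if (k =? n)%nat then c else 0) m
    = if (m <? n)%nat then 0 else c).
  { clear. induction m as [|m IH].
    - rewrite sum_O. destruct n; reflexivity.
    - rewrite rsum_S, IH.
      destruct (Nat.ltb_spec m n); destruct (Nat.ltb_spec (S m) n);
        destruct (Nat.eqb_spec (S m) n); try lia;
        (apply Rplus_0_l || apply Rplus_0_r). }
  rewrite E. now rewrite (proj2 (Nat.ltb_ge m n) Hm).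
Qed.

Definition monomial_basis (n : nat) : C -> C :=
  fun z => (RtoC (/ sqrt (weight n)) * z ^ n)%C.

Lemma coeff_monomial_basis n :
  coeff (monomial_basis n) = fun k => if (k =? n)%nat then RtoC (/ sqrt (weight n)) else RtoC 0.
Proof. apply coeff_eq, has_expansion_monomial. Qed.

Lemma sqrt_weight_pos n : 0 < sqrt (weight n).
Proof. apply sqrt_lt_R0, weight_pos. Qed.

Lemma monomial_basis_orthonormal n m :
  H22_inner (monomial_basis n) (monomial_basis m) = RtoC (if Nat.eqb n m then 1 else 0).
Proof.
  unfold H22_inner. rewrite !coeff_monomial_basis.
  assert (E : (fun k => RtoC (weight k)
      * (if (k =? n)%nat then RtoC (/ sqrt (weight n)) else RtoC 0)
      * Cconj (if (k =? m)%nat then RtoC (/ sqrt (weight m)) else RtoC 0))%C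
    = fun k => RtoC (if (k =? n)%nat then if (n =? m)%nat then 1 else 0 else 0)).
  { apply functional_extensionality. intros k.
    destruct (Nat.eqb_spec k n) as [->|]; destruct (Nat.eqb_spec n m) as [->|];
      try rewrite Nat.eqb_refl;
      apply injective_projections; simpl;
      try (rewrite (proj2 (Nat.eqb_neq n m)) by assumption; simpl); try ring.
    - pose proof (sqrt_weight_pos m).
      rewrite <- (sqrt_sqrt (weight m)) at 1 by (apply Rlt_le, weight_pos). field. lra. }
  rewrite E. unfold CSeries. apply injective_projections; simpl.
  - apply (Series_single (if (n =? m)%nat then 1 else 0)).
  - rewrite (Series_ext _ (fun k => if (k =? 0)%nat then 0 else 0)).
    + apply Series_single.
    + intros k. now destruct (k =? 0)%nat.
Qed.

Lemma monomial_basis_in_H22 n : in_H22 (monomial_basis n).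
Proof.
  split; [apply holomorphic_on_disk_monomial|].
  eexists. split; [apply has_expansion_monomial|].
  eapply ex_series_bounded; [apply weighted_square_ge_0|].
  apply rsum_support_le with (d := n); [apply weighted_square_ge_0|].
  intros k Hk. rewrite (proj2 (Nat.eqb_neq k n)) by lia. rewrite Cmod_0. ring.
Qed.

Lemma monomial_basis_orthonormal_basis : H22_orthonormal_basis monomial_basis.
Proof.
  split; [exact monomial_basis_in_H22|]. split; [exact monomial_basis_orthonormal|].
  intros f Hf eps He. destruct (H22_le_norm f Hf) as [_ [a [Ha Hs]]].
  destruct (H22_le_tail f a _ (eps / 2) Ha Hs ltac:(lra)) as [N HN].
  (* The factor [sqrt (weight k)] cancels the normalization, so the combination is a Taylor
     polynomial of [f]. *)
  exists N, (fun k => (a k * RtoC (sqrt (weight k)))%C).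
  apply Rle_lt_trans with (eps / 2); [|lra]. apply H22_norm_le.
  eapply H22_le_ext; [|exact HN]. intros z _. cbv beta. apply (f_equal (Cminus (f z))).
  apply sum_n_ext. intros k. unfold monomial_basis.
  pose proof (sqrt_weight_pos k).
  assert (E : (RtoC (sqrt (weight k)) * RtoC (/ sqrt (weight k)))%C = RtoC 1).
  { rewrite <- RtoC_mult. f_equal. field. lra. }
  apply (eq_trans (y := (z ^ k * a k * (RtoC (sqrt (weight k)) * RtoC (/ sqrt (weight k))))%C)).
  - rewrite E. ring_in C.
  - ring_in C.
Qed.

(** * Boundedness and the Hilbert-Schmidt sum *)

Lemma sup_norm_lt_1 phi : Rbar_lt (sup_norm phi) (Finite 1) ->
  exists r, 0 <= r < 1 /\ forall z, in_disk z -> Cmod (phi z) <= r.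
Proof.
  intros H. unfold sup_norm in H.
  set (E := fun r : R => _) in H.
  pose proof (proj1 (Lub_Rbar_correct E)) as Hub.
  (* The value at 0 excludes [m_infty] and makes the supremum nonnegative. *)
  assert (H0 : Rbar_le (Cmod (phi 0)) (Lub_Rbar E)).
  { apply Hub. exists 0. split; [unfold in_disk; rewrite Cmod_0; lra | reflexivity]. }
  destruct (Lub_Rbar E) as [r| |]; simpl in H, H0; try contradiction.
  exists r. split; [pose proof (Cmod_ge_0 (phi 0)); lra|].
  intros z Hz. apply (Hub (Cmod (phi z))). now exists z.
Qed.

Theorem theorem4p1 (phi : C -> C) (hphi : in_H22 phi)
  (hsup : Rbar_lt (sup_norm phi) (Finite 1)) :
  H22_Hilbert_Schmidt (composition_operator phi).
Proof.
  destruct (sup_norm_lt_1 phi hsup) as [r [Hr Hphi]].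
  assert (Hdisk : forall z, in_disk z -> in_disk (phi z)).
  { intros z Hz. unfold in_disk. specialize (Hphi z Hz). lra. }
  destruct (H22_le_norm phi hphi) as [_ [a [Ha Hs]]].
  destruct (H22_le_power phi a _ r Ha Hs Hr Hphi) as [K [theta [HK [Hth Hpow]]]].
  assert (Hth1 : 0 < / (1 - theta)) by (apply Rinv_0_lt_compat; lra).
  (* This bound gives both the membership of [f o phi] and the operator bound [K / (1 - theta)], the
     sum of a geometric series. *)
  assert (Hbd : forall f, in_H22 f ->
    H22_le (composition_operator phi f) (K * / (1 - theta) * H22_norm f)).
  { intros f Hf. destruct (H22_le_norm f Hf) as [Hn [b [Hb Hbs]]].
    apply H22_le_series with (fun n z => b n * phi z ^ n)%C
      (fun n => K * H22_norm f * theta ^ n).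
    - intros n. eapply H22_le_mono; [exact (H22_le_scal (b n) _ _ (Hpow n))|].
      pose proof (coef_le b _ Hn Hbs n).
      replace (K * H22_norm f * theta ^ n) with (H22_norm f * (K * theta ^ n)) by ring.
      apply Rmult_le_compat_r; [|assumption].
      apply Rmult_le_pos; [exact HK | now apply pow_le].
    - intros n. rewrite rsum_scal.
      replace (K * / (1 - theta) * H22_norm f) with (K * H22_norm f * / (1 - theta)) by ring.
      apply Rmult_le_compat_l; [now apply Rmult_le_pos | now apply rsum_geom_le].
    - intros z Hz. eapply cconv_ext_loc;
        [|exact (proj1 (has_expansion_cconv f b) Hb (phi z) (Hdisk z Hz))].
      exists 0%nat. intros n _. apply sum_n_ext. intros k. apply Cmult_comm. }
  split.
  - split; [|split].
    + intros f Hf. eapply in_H22_of_le; [|exact (Hbd f Hf)].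
      exact (holomorphic_on_disk_comp f phi (proj1 Hf) (proj1 hphi) Hdisk).
    + reflexivity.
    + exists (K * / (1 - theta)). intros f Hf. apply H22_norm_le. now apply Hbd.
  - exists monomial_basis. split; [exact monomial_basis_orthonormal_basis|].
    (* Here [theta ^ n <= 1] suffices: the squared norms are at most [K ^ 2 / weight n], and the
       inverse weights sum to at most 1. *)
    apply (ex_series_bounded _ (K ^ 2 * 1)); [intros; apply pow2_ge_0|].
    intros N. eapply Rle_trans;
      [|apply Rmult_le_compat_l; [apply pow2_ge_0 | exact (sum_inv_weight_le N)]].
    rewrite <- rsum_scal. apply rsum_le. intros n _.
    assert (Hle : H22_norm (composition_operator phi (monomial_basis n))
      <= / sqrt (weight n) * K).
    { apply H22_norm_le. eapply H22_le_mono.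
      - exact (H22_le_scal (RtoC (/ sqrt (weight n))) _ _ (Hpow n)).
      - pose proof (Rinv_0_lt_compat _ (sqrt_weight_pos n)).
        rewrite Cmod_R, Rabs_pos_eq by lra. apply Rmult_le_compat_l; [lra|].
        assert (theta ^ n <= 1 ^ n) by (apply pow_incr; lra). rewrite pow1 in *. nra. }
    apply Rle_trans with ((/ sqrt (weight n) * K) ^ 2).
    + apply pow_incr. split; [apply sqrt_pos | exact Hle].
    + right. rewrite Rpow_mult_distr, pow_inv, pow2_sqrt by apply Rlt_le, weight_pos. ring.
Qed.
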